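(* Let $D$ be an $SSD(N, s^m)$. Then $$A_2(D) \ge \frac{m(s-1)(ms-m-N+1)}{2(N-1)} + \frac{(N-1)s^2\,\eta(1-\eta)}{2N},$$ where $\eta = \frac{m(N-s)}{(N-1)s} - \left\lfloor \frac{m(N-s)}{(N-1)s} \right\rfloor$ and $\lfloor x\rfloor$ is the largest integer not exceeding $x$. The lower bound is achieved if and only if the numbers of coincidences $\delta_{ij}(D)$, $1\le i<j\le N$, differ from each other by at most one. Furthermore, an $SSD(N,s^m)$ achieving the lower bound is optimal under GMA.
   Context: Designs: $SSD(N,s^m)$ ($N,s\ge 2$, $m\ge 1$) denotes an $N\times m$ matrix $D=[x_{ik}]$ with entries in a set of $s$ symbols, which is balanced: in every column each of the $s$ symbols appears exactly $N/s$ times. (SSD abbreviates ''supersaturated design''; only balanced ones are considered.) The number of coincidences $\delta_{ij}(D)$ between rows $i$ and $j$ is the number of $k$ with $x_{ik}=x_{jk}$. Generalized wordlength pattern: choose orthonormal contrasts on the symbol set, i.e. complex-valued functions $c_1,\dots,c_{s-1}$ on the symbols with $\sum_x c_a(x)=0$ and $\sum_x c_a(x)\overline{c_b(x)}=s$ if $a=b$ and $0$ otherwise. For $j=1,\dots,m$, $$A_j(D)=N^{-2}\sum_{K\subseteq\{1,\dots,m\},\,|K|=j}\ \sum_{(a_k)_{k\in K}\in\{1,\dots,s-1\}^K}\Big|\sum_{i=1}^N\prod_{k\in K}c_{a_k}(x_{ik})\Big|^2 .$$ This does not depend on the choice of orthonormal contrasts. GMA (generalized minimum aberration): $D$ is optimal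 under GMA if it sequentially minimizes $A_1,A_2,A_3,\dots$ among all designs with the same parameters, i.e. there is no $SSD(N,s^m)$ $D'$ and index $r$ with $A_j(D')=A_j(D)$ for all $j<r$ and $A_r(D')<A_r(D)$. *)

(* Defs.v *)
From HB Require Import structures.
From mathcomp Require Import all_boot all_order all_algebra.
From mathcomp Require Import reals complex.

Set Implicit Arguments.
Unset Strict Implicit.
Unset Printing Implicit Defensive.

Import Order.TTheory GRing.Theory Num.Theory.
Local Open Scope ring_scope.

(* The number of symbols is s = #|S|.  Balance is stated as count * s = N, that
   is, the count is exactly N / s; in particular s divides N. *)
Definition is_SSD (S : finType) (N m : nat) (D : 'M[S]_(N, m)) : Prop :=
  forall (k : 'I_m) (x : S), (#|[set i : 'I_N | D i k == x]| * #|S|)%N = N.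

Definition coincidences (S : finType) (N m : nat) (D : 'M[S]_(N, m))
    (i j : 'I_N) : nat :=
  #|[set k : 'I_m | D i k == D j k]|.

Definition orthonormal_contrasts (R : realType) (S : finType)
    (c : 'I_(#|S|.-1) -> S -> R[i]) : Prop :=
  (forall a, \sum_(x : S) c a x = 0) /\
  (forall a b, \sum_(x : S) c a x * (c b x)^*%C =
                 if a == b then #|S|%:R else 0).

(* The generalized wordlength A_j(D) computed with the contrasts c; the families
   (a_k)_{k \in K} are the finite functions on the subtype {k | k \in K}.
   The squared complex modulus is taken as a real number. *)
Definition wordlength (R : realType) (S : finType)
    (c : 'I_(#|S|.-1) -> S -> R[i]) (N m : nat) (j : nat) (D : 'M[S]_(N, m)) : R :=
  (N%:R ^+ 2)^-1 *
  \sum_(K : {set 'I_m} | #|K| == j)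
    \sum_(a : {ffun {k : 'I_m | k \in K} -> 'I_(#|S|.-1)})
      ComplexField.Normc.normc
        (\sum_(i < N) \prod_(k : {k : 'I_m | k \in K}) c (a k) (D i (val k))) ^+ 2.

(* The wordlengths do not depend on the choice of orthonormal contrasts, so the
   designs are compared through one fixed choice c. *)
Definition gma_optimal (R : realType) (S : finType)
    (c : 'I_(#|S|.-1) -> S -> R[i]) (N m : nat) (D : 'M[S]_(N, m)) : Prop :=
  ~ exists (D' : 'M[S]_(N, m)) (r : nat),
      [/\ is_SSD D', (1 <= r <= m)%N,
          forall j, (1 <= j < r)%N -> wordlength c j D' = wordlength c j D
        & wordlength c r D' < wordlength c r D].

Definition eta (R : realType) (N m s : nat) : R :=
  let t : R := m%:R * (N%:R - s%:R) / ((N%:R - 1) * s%:R) in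
  t - (Num.floor t)%:~R.

Definition A2_bound (R : realType) (N m s : nat) : R :=
  m%:R * (s%:R - 1) * (m%:R * s%:R - m%:R - N%:R + 1) / (2 * (N%:R - 1))
  + (N%:R - 1) * s%:R ^+ 2 * eta R N m s * (1 - eta R N m s) / (2 * N%:R).

(* Main.v *)
Require Import Defs.
From mathcomp Require Import all_boot all_order all_algebra.
From mathcomp Require Import reals complex.
From mathcomp Require Import ring lra.
Local Open Scope ring_scope.
Import Order.TTheory GRing.Theory Num.Theory.

Set Implicit Arguments.
Unset Strict Implicit.
Unset Printing Implicit Defensive.

(** Every wordlength is a sum over ordered pairs of rows of a quantity that
depends only on the number of coincidences of the pair.  Indeed a full set of
orthonormal contrasts satisfies the dual orthogonality relation
[\sum_a c_a(x) conj(c_a(y)) = s [x = y] - 1] ([sum_contrasts_dual]); expanding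
the squared modulus and distributing the sum over the families (a_k) turns the
inner sum of A_j into [\sum_K \prod_(k in K) (s [x_ik = x_i'k] - 1)], K of size
j.  This is an elementary symmetric polynomial in d copies of s - 1 and m - d
copies of -1, where d is the number of coincidences, that is, a Krawtchouk
number P_j(d) ([wordlength_krawtchouk]).

In a balanced design each row has m (N - s) / s coincidences in total with the
other rows, so that the mean over pairs of distinct rows is the constant
t = m (N - s) / ((N - 1) s).  Let f be the floor of t.  Since P_2 is quadratic
with leading coefficient s^2 / 2, subtracting the contribution of the mean
gives
  [A_2(D) = bound + s^2 / (2 N^2) * \sum_(i != j) (d_ij - f) (d_ij - f - 1)]
([wordlength2_excess]).  Each term is nonnegative because d_ij and f are
integers, and vanishes exactly when d_ij is f or f + 1 ([excess_term_ge0],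
[excess_eq0]).  As f is the floor of the mean, all d_ij lie in {f, f + 1} as
soon as they differ by at most one ([near_mean_iff]).

For the aberration, A_1 vanishes on every balanced design, A_2 cannot go below
the bound, and a competitor with the same A_2 also has all its d_ij in
{f, f + 1}.  On two consecutive integers every function is affine, so all the
A_r are then determined by the mean t, and coincide for the two designs
([wordlength_near_mean]). *)

(** * Wordlengths as sums over pairs of rows *)

(** Adding the constant function 1 to the contrasts gives a square matrix with
orthogonal rows of squared norm [#|S|]; its columns are then orthogonal too. *)
Lemma sum_contrasts_dual (R : realType) (S : finType)
    (c : 'I_(#|S|.-1) -> S -> R[i]) (x y : S) :
  orthonormal_contrasts c ->
  \sum_a c a x * (c a y)^*%C = #|S|%:R * (x == y)%:R - 1.
Proof.
move=> [c0 cc].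
have S_gt0 : (0 < #|S|)%N by apply/card_gt0P; exists x.
have eS : #|S|.-1.+1 = #|S| by rewrite prednK.
pose sym (j : 'I_#|S|.-1.+1) : S := enum_val (cast_ord eS j).
pose ix (z : S) : 'I_#|S|.-1.+1 := cast_ord (esym eS) (enum_rank z).
have ixK : cancel ix sym by move=> z; rewrite /sym /ix cast_ordKV enum_rankK.
have symK : cancel sym ix by move=> j; rewrite /sym /ix enum_valK cast_ordK.
have sum_sym (F : S -> R[i]) : \sum_j F (sym j) = \sum_z F z.
  by rewrite [RHS](reindex sym) //; exists ix => z _.
(* Row 0 of M is the constant 1, the other rows are the contrasts; M' is the
   conjugate transpose of M divided by #|S|. *)
pose M : 'M[R[i]]_(#|S|.-1.+1) := \matrix_(i, j)
  if unlift ord0 i is Some a then c a (sym j) else 1.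
pose M' : 'M[R[i]]_(#|S|.-1.+1) := \matrix_(j, i) (#|S|%:R^-1 * (M i j)^*%C).
have nz : #|S|%:R != 0 :> R[i] by rewrite pnatr_eq0 -lt0n.
(* The form in which simplification leaves the conjugate of 1. *)
have conj1 : (1 -i* 0)%C = 1 :> R[i] by rewrite oppr0.
have MM' : M *m M' = 1%:M.
  apply/matrixP => i i'; rewrite !mxE.
  under eq_bigr do rewrite !mxE mulrCA.
  rewrite -mulr_sumr.
  apply: (mulfI nz); rewrite mulVKf //.
  case: (unliftP ord0 i) => [a|] -> /=; case: (unliftP ord0 i') => [b|] -> /=.
  - rewrite (sum_sym (fun z => c a z * (c b z)^*%C)) cc (inj_eq lift_inj).
    by case: (a == b); rewrite (mulr1, mulr0).
  - under eq_bigr do rewrite conj1 mulr1.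
    by rewrite sum_sym c0 mulr0.
  - under eq_bigr do rewrite mul1r.
    by rewrite (sum_sym (fun z => (c b z)^*%C)) -rmorph_sum c0 rmorph0 mulr0.
  - rewrite conj1 mulr1 (eq_bigr (fun=> 1)) // sumr_const card_ord mulr1.
    by rewrite eS.
have /matrixP/(_ (ix y) (ix x)) := mulmx1C MM'.
rewrite !mxE big_ord_recl !mxE unlift_none /= conj1 !mulr1.
under eq_bigr => a _ do rewrite !mxE liftK !ixK -mulrA.
rewrite -mulr_sumr (can_eq ixK) => /(congr1 ( *%R #|S|%:R)).
rewrite mulrDr divff // mulVKf // eq_sym => <-.
rewrite [1 + _]addrC addrK.
by apply: eq_bigr => a _; rewrite mulrC.
Qed.

Lemma sqr_normc_sum (R : realType) (I : finType) (F : I -> R[i]) :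
  (ComplexField.Normc.normc (\sum_i F i) ^+ 2)%:C%C =
  \sum_i \sum_j F i * (F j)^*%C.
Proof.
rewrite rmorphXn /= -[(ComplexField.Normc.normc _)%:C%C]/(`|\sum_i F i|).
rewrite sqr_normc rmorph_sum mulr_suml.
by apply: eq_bigr => i _; rewrite mulr_sumr.
Qed.

Lemma wordlength_pairs (R : realType) (S : finType)
    (c : 'I_(#|S|.-1) -> S -> R[i]) (N m j : nat) (D : 'M[S]_(N, m)) :
  orthonormal_contrasts c ->
  wordlength c j D = (N%:R ^+ 2)^-1 * \sum_(i1 < N) \sum_(i2 < N)
    \sum_(K : {set 'I_m} | #|K| == j)
      \prod_(k in K) (#|S|%:R * (D i1 k == D i2 k)%:R - 1).
Proof.
move=> hc; rewrite /wordlength; congr (_ * _).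
under [RHS]eq_bigr => i1 _ do rewrite exchange_big.
rewrite [RHS]exchange_big; apply: eq_bigr => K _ /=.
apply: (@complexI R); rewrite !rmorph_sum /=.
under eq_bigr => a _ do rewrite sqr_normc_sum.
rewrite exchange_big; apply: eq_bigr => i1 _ /=.
rewrite exchange_big rmorph_sum; apply: eq_bigr => i2 _ /=.
rewrite rmorph_prod [RHS]big_sub /=.
under eq_bigr => a _ do rewrite rmorph_prod -big_split /=.
transitivity (\prod_(k : {k | k \in K})
    \sum_a c a (D i1 (val k)) * (c a (D i2 (val k)))^*%C).
  by rewrite bigA_distr_bigA.
apply: eq_bigr => k _; rewrite sum_contrasts_dual //.
by rewrite rmorphB rmorphM !rmorph_nat rmorph1.
Qed.

(** * Krawtchouk numbers *)

(** Elementary symmetric polynomials as coefficients of a product. *)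
Lemma sum_prod_subsets (R : comNzRingType) (I : finType) (w : I -> R) (j : nat) :
  \sum_(K : {set I} | #|K| == j) \prod_(k in K) w k =
  (\prod_k (1 + w k *: 'X))`_j.
Proof.
under [in RHS]eq_bigr => k _ do rewrite addrC.
rewrite bigA_distr coef_sum [LHS]big_mkcond; apply: eq_bigr => K _ /=.
rewrite -big_mkcond /=.
under [in RHS]eq_bigr => k _ do rewrite -mul_polyC.
rewrite big_split /= -rmorph_prod prodr_const coefCM coefXn [_ == #|K|]eq_sym.
by case: eqP => _; rewrite ?mulr1 ?mulr0.
Qed.

(** The generating polynomial of the Krawtchouk numbers: the coefficient of
['X^j] is the j-th elementary symmetric polynomial in d copies of s - 1 and
m - d copies of -1.  It is meaningful for d <= m only, the subtraction m - d
being truncated. *)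
Definition krawtchouk (R : realType) (s m d : nat) : {poly R} :=
  (1 + (s%:R - 1) *: 'X) ^+ d * (1 + (- 1) *: 'X) ^+ (m - d).

Lemma krawtchouk_coincidences (R : realType) (S : finType) (N m : nat)
    (D : 'M[S]_(N, m)) (i1 i2 : 'I_N) :
  \prod_k (1 + (#|S|%:R * (D i1 k == D i2 k)%:R - 1) *: 'X) =
  krawtchouk R #|S| m (coincidences D i1 i2).
Proof.
rewrite (bigID (mem [set k | D i1 k == D i2 k])) /=.
congr (_ * _).
  rewrite (eq_bigr (fun=> 1 + (#|S|%:R - 1) *: 'X)) ?prodr_const // => k.
  by rewrite inE => ->; rewrite mulr1.
rewrite (eq_bigr (fun=> 1 + (- 1) *: 'X)) => [|k]; last first.
  by rewrite inE => /negbTE->; rewrite mulr0 add0r.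
rewrite (eq_bigl (mem (~: [set k | D i1 k == D i2 k]))) => [|k]; last first.
  by rewrite !inE.
rewrite prodr_const; congr (_ ^+ _).
by rewrite cardsCs setCK card_ord.
Qed.

Lemma coef0_binomial (R : comNzRingType) (a : R) (n : nat) :
  ((1 + a *: 'X) ^+ n)`_0 = 1.
Proof.
elim: n => [|n IHn]; first by rewrite expr0 coef1.
by rewrite exprS mulrDl mul1r -scalerAl coefD coefZ coefXM mulr0 addr0.
Qed.

Lemma coef1_binomial (R : comNzRingType) (a : R) (n : nat) :
  ((1 + a *: 'X) ^+ n)`_1 = a * n%:R.
Proof.
elim: n => [|n IHn]; first by rewrite expr0 coef1 mulr0.
rewrite exprS mulrDl mul1r -scalerAl coefD coefZ
  coefXM /=.
by rewrite coef0_binomial IHn -natr1 mulrDr.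
Qed.

Lemma coef2_binomial (R : comNzRingType) (a : R) (n : nat) :
  2 * ((1 + a *: 'X) ^+ n)`_2 = a ^+ 2 * n%:R * (n%:R - 1).
Proof.
elim: n => [|n IHn]; first by rewrite expr0 coef1 /=; ring.
rewrite [_ ^+ n.+1]exprS (mulrDl 1 (a *: 'X)) mul1r -scalerAl coefD coefZ
  coefXM /=.
rewrite coef1_binomial mulrDr IHn -natr1; ring.
Qed.

Lemma krawtchouk1 (R : realType) (s m d : nat) : (d <= m)%N ->
  (krawtchouk R s m d)`_1 = s%:R * d%:R - m%:R.
Proof.
move=> le_dm; rewrite /krawtchouk coefM !big_ord_recl big_ord0 /=.
rewrite !coef0_binomial !coef1_binomial natrB //; ring.
Qed.

Lemma krawtchouk2 (R : realType) (s m d : nat) : (d <= m)%N ->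
  2 * (krawtchouk R s m d)`_2 =
  (s%:R * d%:R - m%:R) ^+ 2 - (s%:R - 1) ^+ 2 * d%:R - (m%:R - d%:R).
Proof.
move=> le_dm; rewrite /krawtchouk coefM !big_ord_recl big_ord0 /=.
rewrite !coef0_binomial !coef1_binomial !mulrDr.
rewrite [2 * (1 * _)]mulrCA [2 * (_`__ * 1)]mulrA !coef2_binomial natrB //; ring.
Qed.

(** The wordlengths only depend on the numbers of coincidences; the pairs with
i1 = i2 are included in the sum. *)
Lemma wordlength_krawtchouk (R : realType) (S : finType)
    (c : 'I_(#|S|.-1) -> S -> R[i]) (N m j : nat) (D : 'M[S]_(N, m)) :
  orthonormal_contrasts c ->
  wordlength c j D = (N%:R ^+ 2)^-1 *
    \sum_(i1 < N) \sum_(i2 < N) (krawtchouk R #|S| m (coincidences D i1 i2))`_j.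
Proof.
move=> hc; rewrite wordlength_pairs //; congr (_ * _).
apply: eq_bigr => i1 _; apply: eq_bigr => i2 _.
by rewrite sum_prod_subsets krawtchouk_coincidences.
Qed.

(** * Coincidences in balanced designs *)

Lemma coincidences_le (S : finType) (N m : nat) (D : 'M[S]_(N, m)) (i j : 'I_N) :
  (coincidences D i j <= m)%N.
Proof. by rewrite -[leqRHS]card_ord max_card. Qed.

Lemma coincidences_sym (S : finType) (N m : nat) (D : 'M[S]_(N, m)) (i j : 'I_N) :
  coincidences D i j = coincidences D j i.
Proof. by apply: eq_card => k; rewrite !inE eq_sym. Qed.

Lemma coincidences_refl (S : finType) (N m : nat) (D : 'M[S]_(N, m)) (i : 'I_N) :
  coincidences D i i = m.
Proof.
by rewrite -[RHS]card_ord; apply: eq_card => k; rewrite !inE eqxx.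
Qed.

(** In each of the m columns, exactly N / s rows, row i included, carry the same
symbol as row i. *)
Lemma sum_coincidences_row (S : finType) (N m : nat) (D : 'M[S]_(N, m)) (i : 'I_N) :
  is_SSD D -> ((\sum_j coincidences D i j) * #|S| = m * N)%N.
Proof.
move=> hD.
under eq_bigr do rewrite /coincidences -sum1dep_card big_mkcond.
rewrite exchange_big big_distrl /= (eq_bigr (fun=> N)) => [|k _].
  by rewrite sum_nat_const card_ord.
rewrite -[RHS](hD k (D i k)) -big_mkcond /= -sum1dep_card.
by congr (_ * _)%N; apply: eq_bigl => j; rewrite eq_sym.
Qed.

(** The mean number of coincidences over the pairs of distinct rows, a constant
for balanced designs; [eta] is its fractional part. *)
Definition mean_coincidence (R : realType) (N m s : nat) : R :=
  m%:R * (N%:R - s%:R) / ((N%:R - 1) * s%:R).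

Lemma sum_coincidences_offdiag (R : realType) (S : finType) (N m : nat)
    (D : 'M[S]_(N, m)) (i : 'I_N) :
  is_SSD D -> (2 <= N)%N -> (0 < #|S|)%N ->
  \sum_(j | j != i) (coincidences D i j)%:R =
  (N%:R - 1) * mean_coincidence R N m #|S|.
Proof.
move=> hD N_ge2 S_gt0.
have s0 : #|S|%:R != 0 :> R by rewrite pnatr_eq0 -lt0n.
have N1 : N%:R - 1 != 0 :> R by rewrite subr_eq0 pnatr_eq1 gtn_eqF.
have /(congr1 (fun n => n%:R : R)) := sum_coincidences_row i hD.
rewrite !natrM natr_sum (bigD1 i) //= coincidences_refl => /esym eq_mN.
apply: (addrI m%:R); apply: (mulIf s0); rewrite -eq_mN /mean_coincidence.
by field; rewrite s0 N1.
Qed.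

(** The floor of the mean as a natural number: balance forces [#|S| <= N], so
that the mean is nonnegative. *)
Lemma mean_coincidence_floor (R : realType) (S : finType) (N m : nat)
    (D : 'M[S]_(N, m)) :
  is_SSD D -> (2 <= N)%N -> (0 < #|S|)%N -> (0 < m)%N ->
  exists f : nat,
    f%:R <= mean_coincidence R N m #|S| < f%:R + 1 /\
    eta R N m #|S| = mean_coincidence R N m #|S| - f%:R.
Proof.
move=> hD N_ge2 /card_gt0P[x _] m_gt0.
have le_SN : (#|S| <= N)%N.
  have := hD (Ordinal m_gt0) x.
  case: #|[set i | D i _ == x]| => [|q] eN; first by rewrite -eN in N_ge2.
  by rewrite -[leqRHS]eN mulSn leq_addr.
have t_ge0 : 0 <= mean_coincidence R N m #|S|.
  rewrite mulr_ge0 ?invr_ge0 ?mulr_ge0 ?ler0n ?subr_ge0 ?ler_nat //.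
  by rewrite ler1n ltnW.
have ef : Num.floor (mean_coincidence R N m #|S|) =
    `|Num.floor (mean_coincidence R N m #|S|)|%N :> int.
  by rewrite gez0_abs // floor_ge0.
exists `|Num.floor (mean_coincidence R N m #|S|)|%N.
have := floor_itv (mean_coincidence R N m #|S|).
rewrite /eta -/(mean_coincidence R N m #|S|) ef.
by rewrite intrD.
Qed.

(** * The excess over the lower bound *)

(** The total deviation from having only f or f + 1 coincidences, summed over
ordered pairs of distinct rows. *)
Definition excess (R : realType) (S : finType) (N m : nat) (D : 'M[S]_(N, m))
    (f : nat) : R :=
  \sum_i \sum_(j | j != i) ((coincidences D i j)%:R - f%:R) *
                           ((coincidences D i j)%:R - f%:R - 1).

Lemma excess_term_ge0 (R : realType) (d f : nat) :
  0 <= (d%:R - f%:R) * (d%:R - f%:R - 1) :> R.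
Proof.
have [le_df|lt_fd] := leqP d f.
  have {}le_df : d%:R <= f%:R :> R by rewrite ler_nat.
  by apply: mulr_le0; lra.
have {}lt_fd : f%:R + 1 <= d%:R :> R by rewrite natr1 ler_nat.
by apply: mulr_ge0; lra.
Qed.

Lemma excess_ge0 (R : realType) (S : finType) (N m : nat) (D : 'M[S]_(N, m))
    (f : nat) : 0 <= excess R D f.
Proof.
by apply: sumr_ge0 => i _; apply: sumr_ge0 => j _; apply: excess_term_ge0.
Qed.

Lemma excess_eq0 (R : realType) (S : finType) (N m : nat) (D : 'M[S]_(N, m))
    (f : nat) :
  excess R D f = 0 <->
  (forall i j, j != i -> (f <= coincidences D i j <= f.+1)%N).
Proof.
split=> [/eqP|near].
  rewrite psumr_eq0 => [/allP/= row0 i j neq_ji|i _]; last first.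
    by apply: sumr_ge0 => j _; apply: excess_term_ge0.
  have := row0 i (mem_index_enum i).
  rewrite psumr_eq0 => [/allP/(_ j (mem_index_enum j))|k _]; last first.
    exact: excess_term_ge0.
  rewrite neq_ji /= mulf_eq0 -addrA -opprD natr1 !subr_eq0 !eqr_nat.
  by case/orP => /eqP->; rewrite leqnn leqnSn.
rewrite /excess big1 // => i _; rewrite big1 // => j /(near i j).
case/andP; rewrite leq_eqVlt => /predU1P[->|]; first by rewrite subrr mul0r.
move=> lt le; rewrite (@anti_leq (coincidences D i j) f.+1) ?lt ?le //.
by rewrite -natr1; ring.
Qed.

Lemma sumr_offdiag_const (R : realType) (N : nat) (i : 'I_N) (x : R) :
  \sum_(j | j != i) x = (N%:R - 1) * x.
Proof.
apply: (addrI x); rewrite -(bigD1 i (P := xpredT)) //= sumr_const card_ord.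
by rewrite -mulr_natl; ring.
Qed.

(** If some pair had fewer than f coincidences, closeness would leave at most f
for every pair, hence a mean below f; if some pair had more than f + 1, every
pair would have at least f + 1, hence a mean of at least f + 1. *)
Lemma near_mean_iff (R : realType) (S : finType) (N m f : nat)
    (D : 'M[S]_(N, m)) :
  is_SSD D -> (2 <= N)%N -> (0 < #|S|)%N ->
  f%:R <= mean_coincidence R N m #|S| < f%:R + 1 ->
  (forall i j, j != i -> (f <= coincidences D i j <= f.+1)%N) <->
  (forall i j i' j' : 'I_N, (i < j)%N -> (i' < j')%N ->
     (coincidences D i j <= coincidences D i' j' + 1)%N).
Proof.
move=> hD N_ge2 S_gt0 /andP[le_ft lt_tf].
split=> [near i j i' j' lt_ij lt_ij'|close].
  have /andP[_ le1] : (f <= coincidences D i j <= f.+1)%N.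
    by rewrite near // neq_ltn lt_ij orbT.
  have /andP[le2 _] : (f <= coincidences D i' j' <= f.+1)%N.
    by rewrite near // neq_ltn lt_ij' orbT.
  by rewrite (leq_trans le1) // addn1 ltnS.
have close2 i j i' j' : j != i -> j' != i' ->
    (coincidences D i j <= coincidences D i' j' + 1)%N.
  rewrite !neq_ltn => /orP[] lt1 /orP[] lt2.
  - by rewrite coincidences_sym [coincidences D i' j']coincidences_sym close.
  - by rewrite coincidences_sym close.
  - by rewrite [coincidences D i' j']coincidences_sym close.
  - by rewrite close.
have N1 : 0 < N%:R - 1 :> R by rewrite subr_gt0 ltr1n.
move=> i j neq_ji.
have tot := @sum_coincidences_offdiag R S N m D i hD N_ge2 S_gt0.
rewrite (bigD1 j) //= in tot; have cst := @sumr_offdiag_const R N i.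
rewrite andbC; apply/andP; split; rewrite leqNgt; apply/negP => lt_d.
- have : (N%:R - 1) * (f%:R + 1) <= (N%:R - 1) * mean_coincidence R N m #|S|.
    rewrite -tot -cst (bigD1 j) //=; apply: lerD.
      by rewrite natr1 ler_nat ltnW.
    apply: ler_sum => k /andP[neq_ki _].
    have := leq_trans lt_d (close2 _ _ _ _ neq_ji neq_ki).
    by rewrite addn1 ltnS natr1 ler_nat.
  by rewrite ler_pM2l // leNgt lt_tf.
- have : (N%:R - 1) * mean_coincidence R N m #|S| < (N%:R - 1) * f%:R.
    rewrite -tot -cst [ltRHS](bigD1 j) //=; apply: ltr_leD.
      by rewrite ltr_nat.
    apply: ler_sum => k /andP[neq_ki _].
    have := leq_trans (close2 _ _ _ _ neq_ki neq_ji) _; rewrite ler_nat; apply.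
    by rewrite addn1.
  by rewrite ltr_pM2l // ltNge le_ft.
Qed.

(** When f is the integer subtracted from the mean in [eta], the excess is,
up to scaling, the distance from A_2 to its lower bound. *)
Lemma wordlength2_excess (R : realType) (S : finType)
    (c : 'I_(#|S|.-1) -> S -> R[i]) (N m f : nat) (D : 'M[S]_(N, m)) :
  orthonormal_contrasts c -> is_SSD D -> (2 <= N)%N -> (0 < #|S|)%N ->
  eta R N m #|S| = mean_coincidence R N m #|S| - f%:R ->
  wordlength c 2 D = A2_bound R N m #|S| +
    #|S|%:R ^+ 2 / (2 * N%:R ^+ 2) * excess R D f.
Proof.
move=> hc hD N_ge2 S_gt0 eta_f.
have s0 : #|S|%:R != 0 :> R by rewrite pnatr_eq0 -lt0n.
have N0 : N%:R != 0 :> R by rewrite pnatr_eq0 -lt0n ltnW.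
have N1 : N%:R - 1 != 0 :> R by rewrite subr_eq0 pnatr_eq1 gtn_eqF.
rewrite wordlength_krawtchouk // /excess.
set s : R := #|S|%:R; set n : R := N%:R; set M : R := m%:R; set F : R := f%:R.
set t := mean_coincidence R N m #|S|.
(* The coefficients of the affine part of 2 P_2(d) once the quadratic part is
   written s ^+ 2 * (d - f) * (d - f - 1). *)
pose al : R := s ^+ 2 * (2 * F + 1) - 2 * s * M - s ^+ 2 + 2 * s.
pose be : R := M ^+ 2 - M - s ^+ 2 * F * (F + 1).
have krawE d : (d <= m)%N -> (krawtchouk R #|S| m d)`_2 =
    s ^+ 2 / 2 * ((d%:R - F) * (d%:R - F - 1)) + (al / 2 * d%:R + be / 2).
  move=> le_dm; apply: (@mulfI _ 2); first by rewrite pnatr_eq0.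
  by rewrite krawtchouk2 // -/s -/M /al /be; field.
have rowE i : \sum_j (krawtchouk R #|S| m (coincidences D i j))`_2 =
    s ^+ 2 / 2 * (\sum_(j | j != i) ((coincidences D i j)%:R - F) *
                           ((coincidences D i j)%:R - F - 1)) +
    (s ^+ 2 / 2 * ((M - F) * (M - F - 1)) + (al / 2 * M + be / 2) +
     (al / 2 * ((n - 1) * t) + (n - 1) * (be / 2))).
  rewrite (bigD1 i) //= coincidences_refl krawE //.
  under eq_bigr => j _ do rewrite krawE ?coincidences_le //.
  rewrite !big_split /= -!mulr_sumr sum_coincidences_offdiag //.
  by rewrite sumr_offdiag_const -/n -/M -/t; ring.
under eq_bigr => i _ do rewrite rowE.
rewrite big_split /= -mulr_sumr sumr_const card_ord -[_ *+ N]mulr_natl -/n.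
rewrite /A2_bound eta_f /t /mean_coincidence /al /be -/s -/n -/M -/F.
by field; rewrite N0 N1 s0.
Qed.

(** * Consequences for generalized minimum aberration *)

(** If all pairs of distinct rows have f or f + 1 coincidences, then every
wordlength is determined by the parameters and f. *)
Lemma wordlength_near_mean (R : realType) (S : finType)
    (c : 'I_(#|S|.-1) -> S -> R[i]) (N m r f : nat) (D : 'M[S]_(N, m)) :
  orthonormal_contrasts c -> is_SSD D -> (2 <= N)%N -> (0 < #|S|)%N ->
  (forall i j, j != i -> (f <= coincidences D i j <= f.+1)%N) ->
  let g d := (krawtchouk R #|S| m d)`_r in
  wordlength c r D = (N%:R ^+ 2)^-1 * \sum_(i < N)
    (g m + (N%:R - 1) *
       (g f + (mean_coincidence R N m #|S| - f%:R) * (g f.+1 - g f))).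
Proof.
move=> hc hD N_ge2 S_gt0 near g.
rewrite wordlength_krawtchouk //; congr (_ * _); apply: eq_bigr => i _.
rewrite (bigD1 i) //= coincidences_refl; congr (_ + _).
(* On {f, f + 1}, g agrees with its affine interpolation. *)
transitivity (\sum_(j | j != i)
    ((g f.+1 - g f) * (coincidences D i j)%:R + (g f - f%:R * (g f.+1 - g f)))).
  apply: eq_bigr => j /(near i j) /andP[]; rewrite leq_eqVlt.
  case/predU1P=> [<- _|lt le]; first by rewrite -/(g f); ring.
  rewrite (@anti_leq (coincidences D i j) f.+1) ?lt ?le // -/(g f.+1) -natr1; ring.
rewrite big_split /= -mulr_sumr sum_coincidences_offdiag // sumr_offdiag_const.
ring.
Qed.

Lemma wordlength1 (R : realType) (S : finType)
    (c : 'I_(#|S|.-1) -> S -> R[i]) (N m : nat) (D : 'M[S]_(N, m)) :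
  orthonormal_contrasts c -> is_SSD D -> wordlength c 1 D = 0.
Proof.
move=> hc hD; rewrite wordlength_krawtchouk // big1 ?mulr0 // => i _.
under eq_bigr => j _ do rewrite krawtchouk1 ?coincidences_le //.
rewrite sumrB -mulr_sumr -natr_sum -natrM mulnC sum_coincidences_row //.
by rewrite sumr_const card_ord mulrnA subrr.
Qed.

Theorem theorem1 (R : realType) (S : finType) (N m s : nat)
    (hs : #|S| = s) (N_ge2 : (2 <= N)%N) (s_ge2 : (2 <= s)%N) (m_ge1 : (1 <= m)%N)
    (c : 'I_(#|S|.-1) -> S -> R[i]) (hc : orthonormal_contrasts c)
    (D : 'M[S]_(N, m)) (hD : is_SSD D) :
  [/\ A2_bound R N m s <= wordlength c 2 D,
      wordlength c 2 D = A2_bound R N m s <->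
        (forall i j i' j' : 'I_N, (i < j)%N -> (i' < j')%N ->
           (coincidences D i j <= coincidences D i' j' + 1)%N)
    & wordlength c 2 D = A2_bound R N m s -> gma_optimal c D].
Proof.
subst s; have S_gt0 : (0 < #|S|)%N by apply: ltnW.
have [f [f_itv eta_f]] := @mean_coincidence_floor R S N m D hD N_ge2 S_gt0 m_ge1.
have A2E (E : 'M_(N, m)) (hE : is_SSD E) :=
  @wordlength2_excess R S c N m f E hc hE N_ge2 S_gt0 eta_f.
have coef_gt0 : 0 < #|S|%:R ^+ 2 / (2 * N%:R ^+ 2) :> R.
  by rewrite divr_gt0 ?mulr_gt0 ?exprn_gt0 ?ltr0n // ltnW.
have boundP (E : 'M_(N, m)) : is_SSD E ->
    wordlength c 2 E = A2_bound R N m #|S| <->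
    (forall i j, j != i -> (f <= coincidences E i j <= f.+1)%N).
  move=> hE; rewrite -(excess_eq0 R) A2E //.
  split=> [|->]; last by rewrite mulr0 addr0.
  rewrite -[RHS]addr0 => /addrI/eqP.
  by rewrite mulf_eq0 gt_eqF //= => /eqP.
have bound_le (E : 'M_(N, m)) : is_SSD E -> A2_bound R N m #|S| <= wordlength c 2 E.
  by move=> hE; rewrite A2E // lerDl mulr_ge0 ?excess_ge0 // ltW.
split; first exact: bound_le.
  by rewrite boundP //; apply: near_mean_iff f_itv.
move=> optD [D' [r [hD' /andP[r_ge1 _] eq_lt lt_r]]].
case: r r_ge1 eq_lt lt_r => [//|[|[|r]]] _ eq_lt.
- by rewrite !wordlength1 // ltxx.
- by rewrite optD ltNge bound_le.
have optD' : wordlength c 2 D' = A2_bound R N m #|S| by rewrite eq_lt.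
have near := (boundP D hD).1 optD; have near' := (boundP D' hD').1 optD'.
rewrite (wordlength_near_mean _ hc hD' _ _ near') //.
by rewrite (wordlength_near_mean _ hc hD _ _ near) // ltxx.
Qed.
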